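(* Let $\nu_1,\nu_2\ge0$, $M>0$, $j\in(0,1]$ and $g\in Lip_M^{\nu_1,\nu_2}(j)$. Then for every $n\in\mathbb{N}$ and every $x>0$ with $\nu_1x+\nu_2>0$, $$|\mathcal{RL}_{n}^{[\alpha]}(g;x)-g(x)|\leq M\left(\frac{\Phi_{n,2}^{\alpha}(x)}{x(\nu_1x+\nu_2)}\right)^{j/2}.$$
   Context: Standing data: $(\beta_n)_{n\in\mathbb N}$ is a strictly increasing sequence of real numbers with $\beta_1=1$ and $\beta_n\to\infty$; $\phi,\psi$ are fixed reals with $0\le\phi\le\psi$; $\alpha=\alpha_n\ge 0$ is a sequence of nonnegative reals (the index $n$ is suppressed). For $i\ge1$ put $x^{(i,-\alpha)}=\prod_{j=1}^{i}(x+(j-1)\alpha)$, and $x^{(0,-\alpha)}=1$. For $x\ge0$ and bounded locally integrable $g$ on $[0,\infty)$ (or, more generally, locally integrable $g$ for which the series converges absolutely) define $$\mathcal{RL}_{n}^{[\alpha]}(g;x)=\beta_n\sum_{i=0}^{\infty}(1+\beta_n\alpha)^{-x/\alpha}\left(\alpha+\frac{1}{\beta_n}\right)^{-i}\frac{x^{(i,-\alpha)}}{i!}\int_{i/\beta_n}^{(i+1)/\beta_n}g\left(\frac{\beta_n t+\phi}{\beta_n+\psi}\right)dt,$$ where for $\alpha=0$ the factor $(1+\beta_n\alpha)^{-x/\alpha}$ is read as its limit $e^{-\beta_n x}$. Put $\Phi_{n,2}^{\alpha}(x)=\mathcal{RL}_{n}^{[\alpha]}((t-x)^2;x)$, the operator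 acting on the function of the variable $t$. $C_B[0,\infty)$ is the space of bounded continuous real functions on $[0,\infty)$, and $$Lip_M^{\nu_1,\nu_2}(j)=\left\{g\in C_B[0,\infty):\ |g(y)-g(x)|\le M\frac{|y-x|^j}{(y+\nu_1x^2+\nu_2x)^{j/2}}\ \text{ for all } x,y\in(0,\infty)\right\}.$$ *)

(* Defs.v *)
From mathcomp Require Import all_boot all_order all_algebra.
From mathcomp Require Import all_classical all_reals all_analysis.

Set Implicit Arguments.
Unset Strict Implicit.
Unset Printing Implicit Defensive.

Import Order.TTheory GRing.Theory Num.Theory.
Import numFieldNormedType.Exports.

Local Open Scope classical_set_scope.
Local Open Scope ring_scope.

(* Functions on [0, +oo) are represented by total functions R -> R.  When
   0 <= phi, 0 <= psi and 0 < b, the definitions below only depend on the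
   values at nonnegative arguments. *)

Section Operators.
Context {R : realType}.
Implicit Types (a b phi psi x : R) (g : R -> R) (i : nat).

(* The factorial power x^{(i,-a)} = x (x + a) ... (x + (i-1) a). *)
Definition factpow a x i : R := \prod_(0 <= k < i) (x + k%:R * a).

(* (1 + b a)^{-x/a}, read as its limit e^{-b x} when a = 0. *)
Definition RLfactor b a x : R :=
  if a == 0 then expR (- (b * x)) else (1 + b * a) `^ (- (x / a)).

(* The operator RL_n^{[alpha]}, with b = beta_n and a = alpha_n. *)
Definition RL phi psi b a g x : R :=
  b * limn (series (fun i =>
        RLfactor b a x * (a + b^-1) ^- i * (factpow a x i / i`!%:R)
        * (\int[lebesgue_measure]_(t in `[i%:R / b, i.+1%:R / b])
             g ((b * t + phi) / (b + psi))))).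

Definition Phi2 phi psi b a x : R :=
  RL phi psi b a (fun t => (t - x) ^+ 2) x.

(* C_B[0, +oo); continuity at 0 is one-sided. *)
Definition CB : set (R -> R) :=
  [set g : R -> R | {within `[(0 : R), +oo[, continuous g} /\
           exists K : R, forall x, 0 <= x -> `|g x| <= K].

Definition Lip (M nu1 nu2 j : R) : set (R -> R) :=
  [set g : R -> R | CB g /\
    forall x y, 0 < x -> 0 < y ->
      `|g y - g x| <=
        M * (`|y - x| `^ j / (y + nu1 * x ^+ 2 + nu2 * x) `^ (j / 2))].

End Operators.

(* Main.v *)
(* The operator averages [g] against the weights [RLweight], which are
   nonnegative and sum to 1: they are the Poisson weights when [a = 0] and the
   negative binomial weights when [a > 0], in which case the sum comes from the
   differential equation [(1 - a z) F' = x F] satisfied by the power series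
   [F z = \sum_i x^{(i,-a)} / i! z^i].  In place of Hoelder's inequality, the
   concave function [u `^ (j / 2)] is replaced by its tangent at [s]: this
   turns the Lipschitz condition into
   [|g y - g x| <= A (y - x)^2 + B], an inequality that linear positive
   averaging preserves.  Choosing [s = Phi2] (or letting [s] tend to 0 if
   [Phi2] is not positive) then gives the bound. *)
Require Import Defs.
From mathcomp Require Import all_boot all_order all_algebra.
From mathcomp Require Import all_classical all_reals all_analysis.
From mathcomp Require Import ring lra.

Import Order.TTheory GRing.Theory Num.Theory.
Import numFieldNormedType.Exports.

Local Open Scope classical_set_scope.
Local Open Scope ring_scope.

(** * Convergence of nonnegative series with quadratic moments *)

Lemma is_cvg_series_ratio (R : realType) (u : R^nat) (q : R) (N : nat) :
  (forall n, 0 <= u n) -> q < 1 ->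
  (forall n, (N <= n)%N -> u n.+1 <= q * u n) -> cvgn (series u).
Proof.
move=> u0 q1 uq.
apply: near_nondecreasing_is_cvgn.
  by apply: nearW => n m nm; exact: nondecreasing_series.
(* [series u n + u n / (1 - q)] is nonincreasing from rank [N] on. *)
pose v n := series u n + u n / (1 - q).
have q10 : 0 < 1 - q by rewrite subr_gt0.
have vN k : v (N + k)%N <= v N.
  elim: k => [|k]; first by rewrite addn0.
  apply: le_trans; rewrite addnS /v seriesSr [leRHS]addrC addrC.
  have -> : u (N + k)%N / (1 - q) = u (N + k)%N + q * u (N + k)%N / (1 - q).
    by field; rewrite gt_eqF.
  have := uq (N + k)%N (leq_addr _ _).
  rewrite -(@ler_pM2r _ (1 - q)^-1) ?invr_gt0//.
  lra.
exists N => // n /= Nn; apply: le_trans (_ : v n <= v N).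
  by rewrite /v lerDl divr_ge0// ltW.
by rewrite -(subnKC Nn).
Unshelve. all: by end_near. Qed.

(* The recursion [hrec] is shared by the negative binomial weights ([0 < z])
   and the Poisson weights ([z = 0]). *)
Lemma is_cvg_series_moment2 (R : realType) (p : R^nat) (y z : R) :
  (forall i, 0 <= p i) -> 0 <= y -> 0 <= z < 1 ->
  (forall i, i.+1%:R * p i.+1 = (y + i%:R * z) * p i) ->
  cvgn (series (fun i => i.+1%:R * i.+2%:R * p i)).
Proof.
move=> p0 y0 /andP[z0 z1] hrec.
(* The ratio of consecutive terms tends to [z]; the midpoint [q] of [z] and 1 leaves room to bound
   it eventually. *)
pose q := (1 + z) / 2.
have q1 : q < 1 by rewrite /q; lra.
have qz : 0 < q - z by rewrite /q; lra.
(* The final inequality is [(t + 3) (y + t z) <= q (t + 1)^2]. For [1 <= t] its left side is at most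
   [z t^2 + (4 y + 3 z) t], so [4 y + 3 z <= (q - z) t] suffices. The successor in [N] guarantees
   [1 <= t]. *)
pose N := (Num.bound ((4 * y + 3 * z) / (q - z))).+1.
apply: (@is_cvg_series_ratio _ _ q N) => // [i|i Ni].
  by rewrite !mulr_ge0.
set t : R := i%:R.
have tE : i.+1%:R = t + 1 :> R by rewrite -natr1.
have tE2 : i.+2%:R = t + 2 :> R by rewrite -addn2 natrD.
have tE3 : i.+3%:R = t + 3 :> R by rewrite -addn3 natrD.
have t1 : 1 <= t by rewrite /t ler1n (leq_trans _ Ni).
have tN : 4 * y + 3 * z <= (q - z) * t.
  rewrite [leRHS]mulrC -ler_pdivrMr//; apply: le_trans (_ : N%:R <= _).
    apply: ltW; apply: lt_trans (archi_boundP _) _; last by rewrite ltr_nat.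
    by apply: divr_ge0; [rewrite addr_ge0 ?mulr_ge0|exact: ltW].
  by rewrite ler_nat.
have h := hrec i; rewrite tE -/t in h.
rewrite tE tE2 tE3.
have -> : p i.+1 = (y + t * z) * p i / (t + 1).
  by rewrite -h; field; rewrite gt_eqF//; lra.
have -> : (t + 2) * (t + 3) * ((y + t * z) * p i / (t + 1)) =
  (t + 2) * p i * ((t + 3) * (y + t * z) / (t + 1)).
  by field; rewrite gt_eqF//; lra.
have -> : q * ((t + 1) * (t + 2) * p i) = (t + 2) * p i * (q * (t + 1)) by ring.
apply: ler_wpM2l; first by rewrite mulr_ge0//; lra.
rewrite ler_pdivrMr; last lra.
nra.
Qed.

Lemma is_cvg_series_moment0 (R : realType) (p : R^nat) :
  (forall i, 0 <= p i) -> cvgn (series (fun i => i.+1%:R * i.+2%:R * p i)) ->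
  cvgn (series p).
Proof.
move=> p0; apply: series_le_cvg => // i; first by rewrite !mulr_ge0.
by rewrite ler_peMl// -natrM ler1n.
Qed.

(** * The negative binomial series and its differential equation *)

Section negative_binomial_series.
Variables (R : realType) (x a : R).
Hypotheses (x0 : 0 <= x) (a0 : 0 <= a).

Let c (i : nat) : R := factpow a x i / i`!%:R.

Lemma factpow_ge0 i : 0 <= factpow a x i.
Proof. by rewrite prodr_ge0// => k _; rewrite addr_ge0// mulr_ge0. Qed.

Let c_ge0 i : 0 <= c i.
Proof. by rewrite divr_ge0// factpow_ge0. Qed.

(** This is the differential equation [(1 - a z) F' = x F] read on coefficients; multiplied by
    [K ^+ i.+1] it is also the recursion behind the moment bounds. *)
Lemma factpow_rec i : i.+1%:R * (factpow a x i.+1 / i.+1`!%:R) =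
  (x + i%:R * a) * (factpow a x i / i`!%:R).
Proof.
rewrite /factpow big_nat_recr//= factS natrM.
by field; rewrite (pnatr_eq0 _ i`!) -lt0n fact_gt0 nat1r pnatr_eq0.
Qed.

Lemma is_cvg_factpow_moment2 (K : R) : 0 <= K -> a * K < 1 ->
  cvgn (series (fun i => i.+1%:R * i.+2%:R * (c i * K ^+ i))).
Proof.
move=> K0 aK1; apply: (@is_cvg_series_moment2 _ _ (x * K) (a * K)) => [i|||i].
- by rewrite mulr_ge0// exprn_ge0.
- exact: mulr_ge0.
- by rewrite mulr_ge0.
- by rewrite mulrA factpow_rec exprS; rewrite -/(c i); ring.
Qed.

Section at_radius.
Variable K : R.
Hypotheses (K0 : 0 <= K) (aK1 : a * K < 1).

(** Term-by-term differentiation with [pseries_snd_diffs] relies on convergence at [K] of the series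
    and of its first two formal derivatives. Their coefficients are [c i] times factors growing at
    most quadratically in [i], so one comparison serves all three. *)
Let cvg_moment (M : R) (u : R^nat) : 0 <= M -> (forall i, 0 <= u i) ->
  (forall i, u i <= M * (i.+1%:R * i.+2%:R)) ->
  cvgn (series (fun i => u i * (c i * K ^+ i))).
Proof.
move=> M0 u0 uM.
have p0 i : 0 <= c i * K ^+ i by rewrite mulr_ge0// exprn_ge0.
apply: (@series_le_cvg _ _
  (M *: (fun i => i.+1%:R * i.+2%:R * (c i * K ^+ i)))) => [i|i|i|].
- by rewrite mulr_ge0.
- by apply: (mulr_ge0 M0); rewrite mulr_ge0.
- by rewrite [leRHS]mulrA ler_wpM2r.
- by apply: is_cvg_seriesZ; exact: is_cvg_factpow_moment2.
Qed.

Let cvg0 : cvgn (pseries c K).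
Proof.
rewrite /pseries; under eq_fun do rewrite -[_ * _]mul1r.
apply: (@cvg_moment 1) => // i; rewrite mul1r.
by rewrite -natrM ler1n.
Qed.

Let diffsE i : pseries_diffs c i = (x + i%:R * a) * c i.
Proof. exact: factpow_rec. Qed.

Let wei (i : nat) : x + i%:R * a <= (x + a) * i.+1%:R.
Proof.
rewrite -natr1 mulrDr mulr1 mulrDl [_ * a]mulrC.
by rewrite -subr_ge0; have := mulr_ge0 x0 (ler0n R i); have := a0; lra.
Qed.

Let cvg1 : cvgn (pseries (pseries_diffs c) K).
Proof.
rewrite /pseries; under eq_fun do rewrite diffsE -mulrA.
apply: (@cvg_moment (x + a)) => [|i|i]; first exact: addr_ge0.
  by rewrite addr_ge0// mulr_ge0.
apply: le_trans (wei i) _; rewrite ler_wpM2l ?addr_ge0//.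
by rewrite ler_peMr// ler1n.
Qed.

Let cvg2 : cvgn (pseries (pseries_diffs (pseries_diffs c)) K).
Proof.
rewrite /pseries.
have E i : pseries_diffs (pseries_diffs c) i * K ^+ i =
    (x + i.+1%:R * a) * (x + i%:R * a) * (c i * K ^+ i).
  rewrite {1}/pseries_diffs diffsE.
  transitivity ((x + i.+1%:R * a) * pseries_diffs c i * K ^+ i).
    by rewrite /pseries_diffs; ring.
  by rewrite diffsE; ring.
under eq_fun do rewrite E.
apply: (@cvg_moment ((x + a) ^+ 2)) => [|i|i]; first exact: sqr_ge0.
  by rewrite mulr_ge0// addr_ge0// mulr_ge0.
apply: le_trans (ler_pM _ _ (wei _) (wei _)) _; rewrite ?addr_ge0 ?mulr_ge0//.
by rewrite le_eqVlt; apply/orP; left; apply/eqP; ring.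
Qed.

(** By [factpow_rec], [x c_i = (i + 1) c_(i+1) - a i c_i]. Multiplying by [z^i] and summing gives
    [F' - a z F'], where [pseries_diffs_equiv] identifies the sum of the [i c_i z^(i-1)] with
    [F']. *)
Lemma factpow_ode (z : R) : `|z| < K ->
  (1 - a * z) * limn (pseries (pseries_diffs c) z) = x * limn (pseries c z).
Proof.
move=> zK; have zK' : `|z| < `|K| by rewrite (ger0_norm K0).
have c0 := is_cvg_pseries_inside cvg0 zK'.
have c1 := is_cvg_pseries_inside cvg1 zK'.
have c1' := pseries_diffs_equiv c1.
rewrite mulrBl mul1r; set F' := limn (pseries (pseries_diffs c) z).
apply/esym; rewrite -[LHS]/(x *: limn _) -(lim_seriesZ _ c0).
apply: cvg_lim => //.
have -> : series (x *: (fun i => c i * z ^+ i)) =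
   pseries (pseries_diffs c) z
    - (a * z) *: series (fun i => i%:R * c i * z ^+ i.-1).
  rewrite -seriesZ /pseries -seriesN -seriesD; congr series.
  apply/funext => i; rewrite !fctE/= diffsE /GRing.scale/=.
  (* At [i = 0] the exponent [i.-1] is truncated, but its coefficient vanishes. *)
  by case: i => [|i]; rewrite /= ?exprS; ring.
apply: cvgB => //.
by apply: cvgZl_tmp.
Qed.

Lemma is_derive_factpow_series (z : R) : `|z| < K ->
  is_derive z (1 : R) (fun z => limn (pseries c z))
    (limn (pseries (pseries_diffs c) z)).
Proof.
move=> zK; apply: (@pseries_snd_diffs _ _ K) => //.
by rewrite (ger0_norm K0).
Qed.

End at_radius.

(** Uniqueness for the differential equation: [G = F (1 - a y)^(x/a)] has zero derivative, hence
    keeps on [[0, z]] its value 1 at 0. *)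
Lemma factpow_series (z : R) : 0 < a -> 0 <= z -> a * z < 1 ->
  limn (pseries c z) = (1 - a * z) `^ (- (x / a)).
Proof.
move=> ap z0 az1.
(* The midpoint of [z] and [1/a] is a radius containing [z] strictly and still satisfying
   [a K < 1]. *)
pose K := (z + a^-1) / 2.
have zK : z < K.
  by rewrite /K; move: az1; rewrite mulrC -ltr_pdivlMr// mul1r; lra.
have K0 : 0 <= K by exact: ltW (le_lt_trans z0 zK).
have aK1 : a * K < 1.
  rewrite mulrC -ltr_pdivlMr// mul1r /K.
  by move: az1; rewrite mulrC -ltr_pdivlMr// mul1r; lra.
pose F y := limn (pseries c y).
pose G y := F y * (1 - a * y) `^ (x / a).
have dG y : `|y| < K -> is_derive y (1 : R) G 0.
  move=> yK; have dF := is_derive_factpow_series _ K0 aK1 _ yK.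
  have ay : 0 < 1 - a * y.
    rewrite subr_gt0; apply: le_lt_trans aK1.
    by rewrite ler_pM2l// (le_trans (ler_norm _))// ltW.
  have dl : is_derive y (1 : R) (fun y => 1 - a * y) (- a).
    by apply: is_derive_eq; rewrite /GRing.scale/=; ring.
  have dp : is_derive y (1 : R) (fun y => (1 - a * y) `^ (x / a))
     (- a * (x / a * (1 - a * y) `^ (x / a - 1))).
    have := @is_derive1_comp R (fun t => t `^ (x / a)) _ y _ _
      (is_derive1_powR (x / a) ay) dl.
    by rewrite [- a * _]mulrC.
  apply: is_derive_eq; rewrite /GRing.scale/= -/(F y).
  have := factpow_ode _ K0 aK1 _ yK; rewrite -/(F y).
  set F' := limn _ => ode.
  rewrite powRB ?powRr1 ?(gt_eqF ay)// ?implybT// ?ltW//.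
  set P := _ `^ _.
  transitivity (P * ((1 - a * y) * F' - x * F y) / (1 - a * y)).
    by field; rewrite !gt_eqF.
  by rewrite ode subrr mulr0 mul0r.
have Gz : G z = G 0.
  have [||d _] := @MVT_segment _ G (cst 0) 0 z z0.
  - move=> y; rewrite in_itv/= => /andP[y0 yz].
    by apply: dG; rewrite gtr0_norm// (lt_trans yz).
  - apply: derivable_within_continuous => y; rewrite in_itv/= => /andP[y0 yz].
    have := dG y; rewrite ger0_norm// (le_lt_trans yz)// => /(_ isT).
    by move=> /@ex_derive.
  by rewrite /cst mul0r => /subr0_eq.
have F0 : F 0 = 1.
  apply: lim_near_cst => //; exists 1%N => // -[//|n] _ /=.
  rewrite /pseries /series/= big_nat_recl//= big1 ?addr0 => [|i _].
    by rewrite /c /factpow big_nil mulr1 divr1.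
  by rewrite exprS mul0r mulr0.
move: Gz; rewrite /G F0 mulr0 subr0 powR1 mulr1 powRN => /(canRL (mulfK _)).
by rewrite mul1r; apply; rewrite gt_eqF// powR_gt0// subr_gt0.
Qed.

End negative_binomial_series.

(** * The weights of the operator: sign, moments and total mass *)

Section RL_weights.
Variables (R : realType) (b a x : R).
Hypotheses (b0 : 0 < b) (a0 : 0 <= a) (x0 : 0 <= x).

Definition RLweight (i : nat) : R :=
  RLfactor b a x * (a + b^-1) ^- i * (factpow a x i / i`!%:R).

Lemma RLfactor_ge0 : 0 <= RLfactor b a x.
Proof.
by rewrite /RLfactor; case: ifP => _; [exact: expR_ge0|exact: powR_ge0].
Qed.

Let K := (a + b^-1)^-1.

Let ab0 : 0 < a + b^-1. Proof. by rewrite ltr_wpDl// invr_gt0. Qed.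

Let K0 : 0 <= K. Proof. by rewrite invr_ge0 ltW. Qed.

Let aK1 : a * K < 1. Proof. by rewrite ltr_pdivrMr// mul1r ltrDl invr_gt0. Qed.

Let RLweightE :
  RLweight = RLfactor b a x *: (fun i => factpow a x i / i`!%:R * K ^+ i).
Proof.
apply/funext => i; rewrite /RLweight !fctE /GRing.scale/= -exprVn -/K.
by rewrite -mulrA [K ^+ i * _]mulrC.
Qed.

Lemma RLweight_ge0 i : 0 <= RLweight i.
Proof.
apply: mulr_ge0; last by rewrite divr_ge0 ?factpow_ge0.
by rewrite divr_ge0 ?RLfactor_ge0 ?exprn_ge0// ltW.
Qed.

Lemma is_cvg_RLweight_moment2 :
  cvgn (series (fun i => i.+1%:R * i.+2%:R * RLweight i)).
Proof.
have -> : (fun i => i.+1%:R * i.+2%:R * RLweight i) = RLfactor b a x *: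
    (fun i => i.+1%:R * i.+2%:R * (factpow a x i / i`!%:R * K ^+ i)).
  by apply/funext => i; rewrite RLweightE !fctE /GRing.scale/= mulrCA.
by apply: is_cvg_seriesZ; exact: is_cvg_factpow_moment2.
Qed.

Lemma is_cvg_series_RLweight : cvgn (series RLweight).
Proof.
apply: is_cvg_series_moment0; first exact: RLweight_ge0.
exact: is_cvg_RLweight_moment2.
Qed.

(** The weights are [RLfactor] times the terms of the power series at [K]. For [a = 0] this is the
    exponential series at [b x]; for [a > 0], [1 - a K = 1 / (1 + b a)], so the series sums to the
    inverse of [RLfactor]. *)
Lemma sum_RLweight : limn (series RLweight) = 1.
Proof.
have cK : cvgn (series (fun i => factpow a x i / i`!%:R * K ^+ i)).
  apply: is_cvg_series_moment0; last exact: is_cvg_factpow_moment2.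
  by move=> i; rewrite mulr_ge0 ?exprn_ge0// divr_ge0 ?factpow_ge0.
rewrite RLweightE lim_seriesZ// /GRing.scale/= /RLfactor.
have [az|an0] := eqVneq a 0.
  rewrite (_ : (fun i => _) = exp_coeff (b * x)).
    by rewrite -/(expR _) -expRD addNr expR0.
  apply/funext => i; rewrite /exp_coeff/= /K az add0r invrK.
  rewrite mulrAC exprMn [b ^+ i * _]mulrC /factpow; congr (_ * _ / _).
  by under eq_bigr do rewrite mulr0 addr0; rewrite prodr_const_nat subn0.
have ap : 0 < a by rewrite lt_def an0.
have p0 : 0 < 1 + b * a by rewrite ltr_wpDr// mulr_ge0// ltW.
rewrite -/(pseries (fun i => factpow a x i / i`!%:R) K) factpow_series//.
have -> : 1 - a * K = (1 + b * a)^-1.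
  by rewrite /K; field; rewrite !gt_eqF.
by rewrite -powRM ?invr_ge0 ?ltW// mulfV ?gt_eqF// powR1.
Qed.

End RL_weights.

(** * Integrals over the cells and transfer of quadratic bounds to the operator *)

Section RL_bound.
Variables (R : realType) (phi psi b : R).
Hypotheses (phi0 : 0 <= phi) (psi0 : 0 <= psi) (b0 : 0 < b).
Local Notation mu := (@lebesgue_measure R).

Let cell (i : nat) : set R := `[i%:R / b, i.+1%:R / b].
Let node (t : R) : R := (b * t + phi) / (b + psi).

Let bpsi0 : 0 < b + psi. Proof. exact: ltr_wpDr. Qed.

Let node_ge0 i t : cell i t -> 0 <= node t.
Proof.
rewrite /cell/= in_itv/= => /andP[it _]; rewrite divr_ge0 ?(ltW bpsi0)//.
rewrite addr_ge0// mulr_ge0// ?(ltW b0)//; apply: le_trans it.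
by rewrite divr_ge0// ltW.
Qed.

Let cont_node : continuous node.
Proof.
move=> t; rewrite /node; apply: cvgM; last exact: cvg_cst.
by apply: cvgD; [apply: cvgM; [exact: cvg_cst|exact: cvg_id]|exact: cvg_cst].
Qed.

Let mcell i : measurable (cell i : set (measurableTypeR R)).
Proof. exact: measurable_itv. Qed.

Let mu_cell i : mu (cell i) = (b^-1)%:E.
Proof.
rewrite /cell lebesgue_measure_itv/= lte_fin ltr_pM2r ?invr_gt0// ltr_nat.
by rewrite ltnSn -EFinB -mulrBl -natr1 addrAC subrr add0r mul1r.
Qed.

Let Rintegral_cst_cell i r : \int[mu]_(t in cell i) r = r / b.
Proof.
rewrite Rintegral_cst; last exact: mcell.
by rewrite [X in fine X]mu_cell.
Qed.

(** Continuity of [g] is known only within [[0, +oo[], so measurability goes through composition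
    with [node], which maps each cell there; boundedness on a set of finite measure does the
    rest. *)
Lemma integrable_CB_cell g i : CB g ->
  mu.-integrable (cell i) (EFin \o (fun t => g (node t))).
Proof.
move=> [cg [C gC]].
have mg : measurable_fun (cell i) (g \o node).
  apply: (@measurable_comp _ _ _ R R R (`[0, +oo[ : set R)).
  - exact: measurable_itv.
  - by move=> _ [t it <-]/=; rewrite in_itv/= andbT; exact: node_ge0 it.
  - apply: measurable_realfun.subspace_continuous_measurable_fun => //.
  - apply: measurable_funTS.
    exact: measurable_realfun.continuous_measurable_fun.
apply: measurable_bounded_integrable => //.
- by rewrite [ltLHS](mu_cell i) ltry.
- exists C; split; first exact: num_real.
  move=> M CM t it; apply: le_trans (ltW CM); apply: gC.
  exact: node_ge0 it.
Qed.

Lemma integrable_sqr_cell (x : R) i :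
  mu.-integrable (cell i) (EFin \o (fun t => (node t - x) ^+ 2)).
Proof.
apply: continuous_compact_integrable; first exact: segment_compact.
apply: continuous_subspaceT => t.
have c : {for t, continuous (fun t => node t - x)}.
  by apply: cvgB; [exact: cont_node|exact: cvg_cst].
by apply: cvgM.
Qed.

Let icst i (r : R) : mu.-integrable (cell i) (EFin \o (fun=> r)).
Proof.
apply: continuous_compact_integrable; first exact: segment_compact.
by apply: continuous_subspaceT => t; exact: cvg_cst.
Qed.

Let I g i := \int[mu]_(t in cell i) g (node t).
Let I2 x i := \int[mu]_(t in cell i) (node t - x) ^+ 2.

Let I2_ge0 x i : 0 <= I2 x i.
Proof. by apply: Rintegral_ge0 => t _; exact: sqr_ge0. Qed.

(** On the cell, [b t <= i + 1] gives [node t <= (i + 1) (1 + phi) / b], hence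
    [|node t - x| <= (i + 1) L]. Relaxing [(i + 1)^2] to [(i + 1) (i + 2)] matches
    [is_cvg_RLweight_moment2]. *)
Let I2_le x i : 0 <= x ->
  I2 x i <= ((1 + phi) / b + x) ^+ 2 / b * (i.+1%:R * i.+2%:R).
Proof.
move=> x0; set L := (_ / b + x).
have L0 : 0 <= L by rewrite addr_ge0// divr_ge0 ?addr_ge0// ltW.
apply: le_trans (_ : \int[mu]_(t in cell i) (i.+1%:R * L) ^+ 2 <= _).
  apply: le_Rintegral; [exact: mcell|exact: integrable_sqr_cell|exact: icst|].
  move=> t it; have n0 := node_ge0 i t it.
  rewrite -ler_sqrt ?sqr_ge0// !sqrtr_sqr.
  rewrite [leRHS]ger0_norm ?mulr_ge0//.
  apply: le_trans (ler_normB _ _) _; rewrite !ger0_norm// /L mulrDr.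
  apply: lerD; last by rewrite ler_peMl// ler1n.
  apply: le_trans (_ : (b * t + phi) / b <= _).
    apply: ler_wpM2l; last by rewrite lef_pV2 ?posrE// lerDl.
    by move: n0; rewrite /node pmulr_lge0// invr_gt0.
  rewrite mulrA; apply: ler_wpM2r; first by rewrite invr_ge0 ltW.
  rewrite mulrDr mulr1; apply: lerD; last by rewrite ler_peMl// ler1n.
  move: it; rewrite /cell/= in_itv/= => /andP[_].
  by rewrite ler_pdivlMr// mulrC.
rewrite Rintegral_cst_cell exprMn -[leLHS]mulrA [leRHS]mulrC.
apply: ler_wpM2r; first by rewrite divr_ge0 ?sqr_ge0// ltW.
by rewrite expr2 ler_wpM2l// ler_nat.
Qed.

(** Cells have length [1/b] and the weights sum to 1, so [c] is itself the average of the cell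
    integrals [c / b]. The difference is thus [b] times the sum of the [w i * d i], which is
    dominated term by term. *)
Lemma RL_dist_le (a x A B c : R) (g : R -> R) : 0 <= a -> 0 <= x -> CB g ->
  (forall y, 0 <= y -> `|g y - c| <= A * (y - x) ^+ 2 + B) ->
  `|RL phi psi b a g x - c| <= A * Phi2 phi psi b a x + B.
Proof.
move=> a0 x0 gCB gc.
pose w := RLweight R b a x.
have w0 i : 0 <= w i by exact: RLweight_ge0.
have cw : cvgn (series w) by exact: is_cvg_series_RLweight.
have sw : limn (series w) = 1 by exact: sum_RLweight.
have cw2 : cvgn (series (fun i => w i * I2 x i)).
  apply: (@series_le_cvg _ _ ((((1 + phi) / b + x) ^+ 2 / b) *:
     (fun i => i.+1%:R * i.+2%:R * w i))) => [i|i|i|].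
  - by rewrite mulr_ge0.
  - by apply: mulr_ge0; [rewrite divr_ge0 ?sqr_ge0// ltW|rewrite mulr_ge0].
  - rewrite !fctE /GRing.scale/= [leLHS]mulrC [leRHS]mulrA.
    by apply: ler_wpM2r; rewrite ?I2_le.
  - by apply: is_cvg_seriesZ; exact: is_cvg_RLweight_moment2.
have -> : Phi2 phi psi b a x = b * limn (series (fun i => w i * I2 x i)) by [].
have -> : RL phi psi b a g x = b * limn (series (fun i => w i * I g i)) by [].
pose d i := I g i - c / b.
have dE i : `|d i| <= A * I2 x i + B / b.
  have -> : d i = \int[mu]_(t in cell i) (g (node t) - c).
    rewrite RintegralB//; first by congr (_ - _); exact/esym/Rintegral_cst_cell.
    exact: integrable_CB_cell.
  have igc : mu.-integrable (cell i) (EFin \o (fun t => g (node t) - c)).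
    exact: (integrableB (mcell i) (integrable_CB_cell g i gCB) (icst i c)).
  apply: le_trans (le_normr_Rintegral _ igc) _ => //.
  have iA : mu.-integrable (cell i) (EFin \o (fun t => A * (node t - x) ^+ 2)).
    exact: (integrableZl (mcell i) A (integrable_sqr_cell x i)).
  have -> : A * I2 x i + B / b =
      \int[mu]_(t in cell i) (A * (node t - x) ^+ 2 + B).
    rewrite RintegralD//.
    rewrite RintegralZl; [|exact: mcell|exact: integrable_sqr_cell].
    by congr (_ + _); exact/esym/Rintegral_cst_cell.
  apply: le_Rintegral; first exact: mcell.
  - exact: integrable_abse igc.
  - exact: (integrableD (mcell i) iA (icst i B)).
  by move=> t it; apply: gc; exact: node_ge0 it.
pose v i := w i * (A * I2 x i + B / b).
have vE : v = A *: (fun i => w i * I2 x i) + (B / b) *: w.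
  by apply/funext => i; rewrite /v !fctE /GRing.scale/=; ring.
have cv : cvgn (series v).
  by rewrite vE; apply: is_cvg_seriesD; exact: is_cvg_seriesZ.
have lv : b * limn (series v) =
    A * (b * limn (series (fun i => w i * I2 x i))) + B.
  rewrite vE lim_seriesD; [|exact: is_cvg_seriesZ..].
  rewrite !lim_seriesZ// sw.
  by rewrite /GRing.scale/=; field; rewrite gt_eqF.
(* This bound also yields [0 <= v i]. The resulting absolute convergence is what allows the limit
   defining [RL] to be split below. *)
have wd i : `|w i * d i| <= v i by rewrite normrM ger0_norm// ler_wpM2l.
have cd' : cvgn [normed series (fun i => w i * d i)].
  apply: (@series_le_cvg _ _ v) => // i; first exact: normr_ge0.
  exact: le_trans (wd i).
have cd := normed_cvg cd'.
have -> : (fun i => w i * I g i) = (fun i => w i * d i) + (c / b) *: w.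
  by apply/funext => i; rewrite /d !fctE /GRing.scale/=; ring.
rewrite lim_seriesD//; last exact: is_cvg_seriesZ.
rewrite lim_seriesZ// sw [_ *: 1]mulr1 mulrDr mulrCA mulfV ?gt_eqF// mulr1.
rewrite addrK -lv.
rewrite normrM (gtr0_norm b0) ler_pM2l//.
apply: le_trans (lim_series_norm cd') _.
exact: lim_series_le.
Qed.

End RL_bound.

(** * Tangent bound for powers and the quadratic form of the Lipschitz condition *)

(** Young's inequality with exponents [1/th] and [1/(1 - th)] gives
    [u^th s^(1-th) <= th u + (1 - th) s]; multiply by [s^(th-1)]. *)
Lemma powR_tangent (R : realType) (th s u : R) : 0 < th -> th < 1 -> 0 < s ->
  0 <= u -> u `^ th <= th * s `^ (th - 1) * u + (1 - th) * s `^ th.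
Proof.
move=> th0 th1 s0 u0.
have th1' : 0 < 1 - th by rewrite subr_gt0.
have := @conjugate_powR R (u `^ th) (s `^ (1 - th)) th^-1 (1 - th)^-1
  (powR_ge0 _ _) (powR_ge0 _ _).
rewrite !invr_gt0 !invrK -!powRrM !mulfV ?gt_eqF// !powRr1 ?(ltW s0)//.
move=> /(_ th0 th1' (subrKC _ _)) h.
have p0 : 0 < s `^ (th - 1) by exact: powR_gt0.
have E : s `^ (1 - th) * s `^ (th - 1) = 1.
  rewrite -powRD ?(gt_eqF s0) ?implybT//.
  by rewrite (_ : _ + _ = 0) ?powRr0//; ring.
have E2 : s `^ th = s * s `^ (th - 1).
  rewrite -[X in X * _](powRr1 (ltW s0)).
  by rewrite -powRD ?(gt_eqF s0) ?implybT// subrKC.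
rewrite -(ler_pM2r p0) -mulrA E mulr1 in h.
by apply: le_trans h _; rewrite E2 le_eqVlt; apply/orP; left; apply/eqP; ring.
Qed.

(** For [y > 0], dropping [y] from the denominator leaves [w = x (nu1 x + nu2)], and [|y - x|^j] is
    the power [j / 2] of [(y - x)^2], to which the tangent bound at [s] applies. *)
Lemma Lip_sqr_le (R : realType) (M nu1 nu2 j s x y : R) (g : R -> R) :
  0 <= nu1 -> 0 <= nu2 -> 0 < M -> 0 < j -> j <= 1 -> Lip M nu1 nu2 j g ->
  0 < x -> 0 < nu1 * x + nu2 -> 0 < s -> 0 <= y ->
  `|g y - g x| <= M / (x * (nu1 * x + nu2)) `^ (j / 2) *
    (j / 2 * s `^ (j / 2 - 1) * (y - x) ^+ 2 + (1 - j / 2) * s `^ (j / 2)).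
Proof.
move=> nu10 nu20 M0 j0 j1 [[cg _] gL] x0 nux s0 y0.
set w := x * (nu1 * x + nu2).
have w0 : 0 < w by exact: mulr_gt0.
set C := M / _.
have C0 : 0 < C by rewrite divr_gt0// powR_gt0.
set rhs := fun y : R => C *
  (j / 2 * s `^ (j / 2 - 1) * (y - x) ^+ 2 + (1 - j / 2) * s `^ (j / 2)).
have pos z : 0 < z -> `|g z - g x| <= rhs z.
  move=> z0; apply: le_trans (gL _ _ x0 z0) _.
  apply: (@le_trans _ _ (C * ((z - x) ^+ 2) `^ (j / 2))).
    have -> : ((z - x) ^+ 2) `^ (j / 2) = `|z - x| `^ j.
      rewrite -real_normK ?num_real// -powR_mulrn// -powRrM.
      by congr (_ `^ _); field.
    rewrite /C mulrAC -mulrA ler_pM2l// ler_wpM2l ?powR_ge0//.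
    have wz : w <= z + nu1 * x ^+ 2 + nu2 * x.
      by rewrite (_ : _ + _ = z + w) ?lerDr ?ltW// /w; ring.
    rewrite lef_pV2 ?posrE ?powR_gt0//; last exact: lt_le_trans wz.
    apply: ge0_ler_powR; rewrite ?nnegrE ?divr_ge0 ?(ltW j0) ?(ltW w0)//.
    by rewrite (le_trans (ltW w0)).
  rewrite /rhs ler_pM2l//.
  by apply: powR_tangent => //; [lra|lra|exact: sqr_ge0].
(* The Lipschitz condition says nothing at [y = 0]; there the bound is the limit from the right, by
   one-sided continuity of [g]. *)
move: y0; rewrite le_eqVlt => /predU1P[<-|]; last exact: pos.
have [_ g0] := (continuous_within_itvcyP 0 g).1 cg.
have cr : continuous rhs.
  move=> t; apply: cvgM; first exact: cvg_cst.
  apply: cvgD; last exact: cvg_cst.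
  apply: cvgM; first exact: cvg_cst.
  have c : {for t, continuous (fun t : R => t - x)}.
    by apply: cvgB; [exact: cvg_id|exact: cvg_cst].
  by apply: cvgM.
have gx : `|g t - g x| @[t --> 0^'+] --> `|g 0 - g x|.
  by apply: cvg_norm; apply: cvgB => //; exact: cvg_cst.
have rx : rhs t @[t --> 0^'+] --> rhs 0.
  by apply: cvg_at_right_filter; exact: cr.
apply: (ler_cvg_to gx rx).
near=> t; apply: pos.
by near: t; exact: nbhs_right_gt.
Unshelve. all: by end_near. Qed.

(** * Choice of the tangent point *)

Theorem theorem2p4 (R : realType) (beta alpha : nat -> R) (phi psi : R)
  (beta1 : beta 1%N = 1)
  (beta_incr : forall m n : nat, (0 < m)%N -> (m < n)%N -> beta m < beta n)
  (beta_lim : beta n @[n --> \oo] --> +oo)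
  (phi_ge0 : 0 <= phi) (phi_le_psi : phi <= psi)
  (alpha_ge0 : forall n : nat, (0 < n)%N -> 0 <= alpha n)
  (nu1 nu2 M j : R) (nu1_ge0 : 0 <= nu1) (nu2_ge0 : 0 <= nu2)
  (M_gt0 : 0 < M) (j_gt0 : 0 < j) (j_le1 : j <= 1)
  (g : R -> R) (g_Lip : Lip M nu1 nu2 j g) :
  forall (n : nat) (x : R), (0 < n)%N -> 0 < x -> 0 < nu1 * x + nu2 ->
    `|RL phi psi (beta n) (alpha n) g x - g x|
      <= M * (Phi2 phi psi (beta n) (alpha n) x / (x * (nu1 * x + nu2)))
             `^ (j / 2).
Proof.
move=> n x n0 x0 nux.
set Phi := Phi2 _ _ _ _ _; set D := `|_ - _|; set W := x * _.
have W0 : 0 < W by exact: mulr_gt0.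
pose th := j / 2; rewrite -/th.
have th0 : 0 < th by rewrite /th; lra.
have th1 : th <= 1 by rewrite /th; lra.
have b0 : 0 < beta n.
  apply: (@lt_le_trans _ _ (beta 1%N)); first by rewrite beta1.
  by move: n0; rewrite leq_eqVlt => /predU1P[<-//|n1]; exact/ltW/beta_incr.
pose C := M / W `^ th.
have C0 : 0 < C by rewrite divr_gt0// powR_gt0.
have DC s : 0 < s ->
    D <= C * (th * s `^ (th - 1) * Phi + (1 - th) * s `^ th).
  move=> s0; rewrite mulrDr mulrA.
  apply: RL_dist_le => //.
  - exact: le_trans phi_le_psi.
  - exact: alpha_ge0.
  - exact: ltW.
  - by case: g_Lip.
  - move=> y y0; rewrite -mulrA -mulrDr.
    exact: (@Lip_sqr_le _ _ nu1 nu2).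
have [Phi0|Phi0] := ltP 0 Phi.
  apply: le_trans (DC _ Phi0) _.
  (* At [s = Phi] the two terms are [th] and [1 - th] times [Phi^th]. *)
  have -> : th * Phi `^ (th - 1) * Phi = th * Phi `^ th.
    rewrite -mulrA -[X in _ * (_ * X)](powRr1 (ltW Phi0)).
    by rewrite -powRD ?(gt_eqF Phi0) ?implybT// subrK.
  rewrite -mulrDl subrKC mul1r powRM ?invr_ge0 ?(ltW Phi0) ?(ltW W0)//.
  rewrite /C mulrAC -mulrA ler_pM2l// ler_wpM2l ?powR_ge0//.
  by rewrite -(powR_inv1 (ltW W0)) -powRrM mulN1r powRN.
suff -> : D = 0 by rewrite mulr_ge0 ?powR_ge0// ltW.
apply/eqP; rewrite eq_le normr_ge0 andbT leNgt; apply/negP => D0.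
(* A single small [s] suffices: this one makes [C s^th = D / 2]. Since the term in [Phi] is
   nonpositive, [DC] would give [D <= D / 2]. *)
pose s := (D / (2 * C)) `^ th^-1.
have DC0 : 0 < D / (2 * C) by rewrite divr_gt0// mulr_gt0.
have s0 : 0 < s by exact: powR_gt0.
have sth : s `^ th = D / (2 * C).
  by rewrite -powRrM mulVf ?gt_eqF// powRr1// ltW.
have := DC _ s0; apply/negP; rewrite -ltNge.
apply: (@le_lt_trans _ _ (C * s `^ th)); last first.
  rewrite sth (_ : C * _ = D / 2); last by field; rewrite gt_eqF.
  by move: D0; lra.
rewrite ler_pM2l// -[leRHS]add0r lerD//.
  by rewrite mulr_ge0_le0// mulr_ge0 ?powR_ge0// ltW.
by rewrite ler_piMl ?powR_ge0// gerBl ltW.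
Qed.
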